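(* Let $\mathcal{R}$ be a commutative ring with unity, $\mathcal{A}$ a unital $\mathcal{R}$-algebra and $\mathcal{M}$ a unital $\mathcal{A}$-bimodule. All derivations on $\mathcal{A}\ltimes\mathcal{M}$ are inner if and only if the following assertions hold. (1) Every derivation in $\overline{\Gamma}$ is inner. (2) Every derivation in $\mathrm{Der}(\mathcal{A},\mathcal{M})$ is inner. (3) Every $\mathcal{A}$-bimodule homomorphism in $\mathrm{End}_{\mathcal{A}-\mathcal{A}}(\mathcal{M})$ is central inner. (4) $\mathcal{E}(\mathcal{M})=0$.
   Context: $\mathcal{A}\ltimes\mathcal{M}$ is the trivial extension algebra: $\mathcal{A}\times\mathcal{M}$ with componentwise addition and scalar multiplication and product $(a,m)(b,n)=(ab,an+mb)$. Derivations are $\mathcal{R}$-linear; $\mathrm{Der}(\mathcal{A},\mathcal{M})$ is the group of derivations $\mathcal{A}\to\mathcal{M}$, and $\mathrm{Der}(\mathcal{A})$ that of derivations of $\mathcal{A}$. A derivation $\mathcal{A}\to\mathcal{M}$ is inner if it has the form $a\mapsto m_0a-am_0$ with $m_0\in\mathcal{M}$; similarly for derivations of an algebra into itself. For $d\in\mathrm{Der}(\mathcal{A})$, an $\mathcal{R}$-linear map $S:\mathcal{M}\to\mathcal{M}$ is a module generalized $d$-derivation if $S(am)=aS(m)+d(a)m$ and $S(ma)=S(m)a+md(a)$ for all $a\in\mathcal{A}$, $m\in\mathcal{M}$. $\overline{\Gamma}$ is the subgroup of $\mathrm{Der}(\mathcal{A})$ consisting of all $d\in\mathrm{Der}(\mathcal{A})$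 for which there exists a module generalized $d$-derivation $S:\mathcal{M}\to\mathcal{M}$ (equivalently, the image of the projection $(d,S)\mapsto d$ from the group of derivations of $\mathcal{A}\ltimes\mathcal{M}$ of the form $(a,m)\mapsto(d(a),S(m))$). $\mathrm{End}_{\mathcal{A}-\mathcal{A}}(\mathcal{M})$ is the group of $\mathcal{A}$-bimodule homomorphisms $\mathcal{M}\to\mathcal{M}$; such a homomorphism is central inner if it has the form $m\mapsto a_0m-ma_0$ for some $a_0$ in the center $Z(\mathcal{A})$. $\mathcal{E}(\mathcal{M})$ is the group of $\mathcal{A}$-bimodule homomorphisms $f:\mathcal{M}\to\mathcal{A}$ such that $f(m)n+mf(n)=0$ for all $m,n\in\mathcal{M}$. *)

(* Defs.v *)
From HB Require Import structures.
From mathcomp Require Import all_boot all_algebra.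

Set Implicit Arguments.
Unset Strict Implicit.
Unset Printing Implicit Defensive.

Import GRing.Theory.
Local Open Scope ring_scope.

(* Unital associative algebras over R. The library's algType R also demands
   1 != 0; here the zero algebra is allowed. The library admits no new join of
   PzRing and Lmodule, so the module structure is a field of the mixin, from
   which it is made canonical. Storing the library's own mixin keeps the two
   module structures on a trivial extension, or on an algType, convertible. *)
HB.mixin Record isPzAlgebra (R : comPzRingType) A of GRing.PzRing A := {
  pzalg_lmod : GRing.Nmodule_isLSemiModule R A;
  ascalerAl : forall (r : R) (a b : A),
    GRing.Nmodule_isLSemiModule.scale pzalg_lmod r (a * b) =
    GRing.Nmodule_isLSemiModule.scale pzalg_lmod r a * b;
  ascalerAr : forall (r : R) (a b : A),
    GRing.Nmodule_isLSemiModule.scale pzalg_lmod r (a * b) =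
    a * GRing.Nmodule_isLSemiModule.scale pzalg_lmod r b
}.

#[short(type="pzAlgType")]
HB.structure Definition PzAlgebra (R : comPzRingType) :=
  {A of isPzAlgebra R A & GRing.PzRing A}.

#[non_forgetful_inheritance]
HB.instance Definition _ (R : comPzRingType) (A : pzAlgType R) :=
  @pzalg_lmod R A.

Lemma pzscalerAl (R : comPzRingType) (A : pzAlgType R) (r : R) (a b : A) :
  r *: (a * b) = (r *: a) * b.
Proof. exact: ascalerAl. Qed.

Lemma pzscalerAr (R : comPzRingType) (A : pzAlgType R) (r : R) (a b : A) :
  r *: (a * b) = a * (r *: b).
Proof. exact: ascalerAr. Qed.

#[non_forgetful_inheritance]
HB.instance Definition _ (R : comPzRingType) (A : algType R) :=
  isPzAlgebra.Build R A
    (@GRing.scalerAl R A) (@GRing.scalerAr R A).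

Bind Scope ring_scope with PzAlgebra.sort.

(* Unital A-bimodules. lactZl and ractZr say that both A-module structures
   induce the given R-module structure; the remaining compatibilities of the
   actions with scaling are the lemmas lactZr and ractZl. *)
HB.mixin Record isBimodule (R : comPzRingType) (A : pzAlgType R) M
    of GRing.Lmodule R M := {
  lact : A -> M -> M;
  ract : M -> A -> M;
  lactA : forall a b m, lact a (lact b m) = lact (a * b) m;
  lact1 : forall m, lact 1 m = m;
  lactDl : forall a b m, lact (a + b) m = lact a m + lact b m;
  lactDr : forall a m n, lact a (m + n) = lact a m + lact a n;
  ractA : forall m a b, ract (ract m a) b = ract m (a * b);
  ract1 : forall m, ract m 1 = m;
  ractDl : forall m n a, ract (m + n) a = ract m a + ract n a;
  ractDr : forall m a b, ract m (a + b) = ract m a + ract m b;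
  lract : forall a m b, ract (lact a m) b = lact a (ract m b);
  lactZl : forall (r : R) a m, lact (r *: a) m = r *: lact a m;
  ractZr : forall (r : R) m a, ract m (r *: a) = r *: ract m a
}.

#[short(type="bimodType")]
HB.structure Definition Bimodule (R : comPzRingType) (A : pzAlgType R) :=
  {M of isBimodule R A M & GRing.Lmodule R M}.

Bind Scope ring_scope with Bimodule.sort.

Notation "a *> m" := (lact a m) (at level 40, left associativity) : ring_scope.
Notation "m <* a" := (ract m a) (at level 40, left associativity) : ring_scope.

Section BimoduleTheory.
Variables (R : comPzRingType) (A : pzAlgType R) (M : bimodType A).

Lemma lactZr (r : R) (a : A) (m : M) : a *> (r *: m) = r *: (a *> m).
Proof.
by rewrite -[in LHS](lact1 m) -lactZl lactA -pzscalerAr mulr1 lactZl.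
Qed.

Lemma ractZl (r : R) (m : M) (a : A) : (r *: m) <* a = r *: (m <* a).
Proof.
by rewrite -[in LHS](ract1 m) -ractZr ractA -pzscalerAl mul1r ractZr.
Qed.

End BimoduleTheory.

Definition trivext (R : comPzRingType) (A : pzAlgType R) (M : bimodType A) :
  Type := (A * M)%type.

Section TrivialExtension.
Variables (R : comPzRingType) (A : pzAlgType R) (M : bimodType A).

HB.instance Definition _ := GRing.Lmodule.copy (trivext M) (A * M)%type.

Definition trivext_one : trivext M := (1, 0).
Definition trivext_mul (x y : trivext M) : trivext M :=
  (x.1 * y.1, x.1 *> y.2 + x.2 <* y.1).

Lemma trivext_mulDl : left_distributive trivext_mul +%R.
Proof.
move=> [a m] [b n] [c p]; congr (_, _) => /=; first exact: mulrDl.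
by rewrite lactDl ractDl addrACA.
Qed.

Lemma trivext_mulDr : right_distributive trivext_mul +%R.
Proof.
move=> [a m] [b n] [c p]; congr (_, _) => /=; first exact: mulrDr.
by rewrite lactDr ractDr addrACA.
Qed.

Lemma trivext_mulA : associative trivext_mul.
Proof.
move=> [a m] [b n] [c p]; congr (_, _) => /=; first exact: mulrA.
by rewrite lactDr ractDl lactA ractA lract addrA.
Qed.

Lemma trivext_mul1 : left_id trivext_one trivext_mul.
Proof.
move=> [a m]; congr (_, _) => /=; first exact: mul1r.
by rewrite lact1 -(scale0r 0) ractZl !scale0r addr0.
Qed.

Lemma trivext_mulr1 : right_id trivext_one trivext_mul.
Proof.
move=> [a m]; congr (_, _) => /=; first exact: mulr1.
by rewrite ract1 -(scale0r 0) lactZr !scale0r add0r.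
Qed.

HB.instance Definition _ := GRing.Zmodule_isPzRing.Build (trivext M)
  trivext_mulA trivext_mul1 trivext_mulr1 trivext_mulDl trivext_mulDr.

Lemma trivext_scaleAl (r : R) (x y : trivext M) : r *: (x * y) = (r *: x) * y.
Proof.
case: x y => [a m] [b n]; congr (_, _) => /=; first exact: pzscalerAl.
by rewrite lactZl ractZl scalerDr.
Qed.

Lemma trivext_scaleAr (r : R) (x y : trivext M) : r *: (x * y) = x * (r *: y).
Proof.
case: x y => [a m] [b n]; congr (_, _) => /=; first exact: pzscalerAr.
by rewrite lactZr ractZr scalerDr.
Qed.

HB.instance Definition _ :=
  isPzAlgebra.Build R (trivext M)
    trivext_scaleAl trivext_scaleAr.

End TrivialExtension.

Section Derivations.
Variables (R : comPzRingType) (A : pzAlgType R).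

Definition derivation (d : {linear A -> A}) : Prop :=
  forall a b, d (a * b) = d a * b + a * d b.

Definition inner (d : {linear A -> A}) : Prop :=
  exists a0, forall a, d a = a0 * a - a * a0.

Definition central (a0 : A) : Prop := forall a, a0 * a = a * a0.

Variable M : bimodType A.

Definition mod_derivation (d : {linear A -> M}) : Prop :=
  forall a b, d (a * b) = d a <* b + a *> d b.

Definition mod_inner (d : {linear A -> M}) : Prop :=
  exists m0, forall a, d a = m0 <* a - a *> m0.

Definition mod_generalized_derivation
    (d : {linear A -> A}) (S : {linear M -> M}) : Prop :=
  forall a m, S (a *> m) = a *> S m + d a *> m /\
              S (m <* a) = S m <* a + m <* d a.

Definition Gamma_bar (d : {linear A -> A}) : Prop :=
  derivation d /\ exists S : {linear M -> M}, mod_generalized_derivation d S.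

(* In the next two definitions R-linearity is no extra condition: it follows
   from additivity and A-linearity, since r *: m = (r *: 1) *> m. *)
Definition bimod_endo (f : {linear M -> M}) : Prop :=
  forall a m, f (a *> m) = a *> f m /\ f (m <* a) = f m <* a.

Definition bimod_hom_alg (f : {linear M -> A}) : Prop :=
  forall a m, f (a *> m) = a * f m /\ f (m <* a) = f m * a.

Definition central_inner (f : {linear M -> M}) : Prop :=
  exists a0, central a0 /\ forall m, f m = a0 *> m - m <* a0.

Definition calE (f : {linear M -> A}) : Prop :=
  bimod_hom_alg f /\ forall m n, f m *> n + m <* f n = 0.

End Derivations.

(* Main.v *)
Require Import Defs.
From HB Require Import structures.
From mathcomp Require Import all_boot all_algebra.
Import GRing.Theory.
Local Open Scope ring_scope.

(** As an R-module the trivial extension is the direct sum of A and M, so an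
    endomorphism of it is a 2 x 2 matrix with entries d : A -> A, T : M -> A,
    delta : A -> M and S : M -> M. Testing the Leibniz rule on the products
    (a, 0)(b, 0), (a, 0)(0, m), (0, m)(a, 0) and (0, m)(0, n) separates it into
    conditions on the entries ([derivation_block_map]): d is a derivation,
    delta is a derivation into M, T lies in E(M), and S is a module generalized
    d-derivation. Likewise the commutator with (a0, m0) has as its entries the
    commutator with a0 (for d and for S), the commutator with m0 (for delta),
    and T = 0 ([inner_block_map]).

    If all derivations are inner, each of the four assertions follows from the
    block map whose other entries vanish (for the first one, S is kept next to
    d). Conversely, the four assertions nearly provide a0 and m0 at once; only
    d and S have to be implemented by the same element of A. If a0 implements
    d, then S minus the commutator with a0 is a bimodule endomorphism, hence
    the commutator with some central b0, and a0 + b0 implements both, because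
    adding a central element does not change the commutators on A. *)

Section BimoduleActions.
Variables (R : comPzRingType) (A : pzAlgType R) (M : bimodType A).

Lemma lact0 (a : A) : a *> (0 : M) = 0.
Proof. by apply: (addIr (a *> 0)); rewrite -lactDr !add0r. Qed.

Lemma lact0l (m : M) : (0 : A) *> m = 0.
Proof. by apply: (addIr (0 *> m)); rewrite -lactDl !add0r. Qed.

Lemma ract0 (a : A) : (0 : M) <* a = 0.
Proof. by apply: (addIr (0 <* a)); rewrite -ractDl !add0r. Qed.

Lemma ract0r (m : M) : m <* (0 : A) = 0.
Proof. by apply: (addIr (m <* 0)); rewrite -ractDr !add0r. Qed.

Lemma lactN (a : A) (m : M) : a *> (- m) = - (a *> m).
Proof. by apply/eqP; rewrite -addr_eq0 -lactDr addNr lact0. Qed.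

Lemma lactNl (a : A) (m : M) : (- a) *> m = - (a *> m).
Proof. by apply/eqP; rewrite -addr_eq0 -lactDl addNr lact0l. Qed.

Lemma ractN (m : M) (a : A) : (- m) <* a = - (m <* a).
Proof. by apply/eqP; rewrite -addr_eq0 -ractDl addNr ract0. Qed.

Lemma ractNr (m : M) (a : A) : m <* (- a) = - (m <* a).
Proof. by apply/eqP; rewrite -addr_eq0 -ractDr addNr ract0r. Qed.

End BimoduleActions.

Section BimoduleCommutator.
Variables (R : comPzRingType) (A : pzAlgType R) (M : bimodType A).

Definition bimod_comm (a0 : A) (m : M) : M := a0 *> m - m <* a0.

Lemma bimod_comm_linear (a0 : A) : linear (bimod_comm a0).
Proof.
move=> r m n; rewrite /bimod_comm lactDr ractDl lactZr ractZl scalerBr.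
by rewrite opprD addrACA.
Qed.

HB.instance Definition _ (a0 : A) :=
  GRing.isLinear.Build R M M *:%R (bimod_comm a0) (bimod_comm_linear a0).

Lemma bimod_commD (a0 b0 : A) (m : M) :
  bimod_comm (a0 + b0) m = bimod_comm a0 m + bimod_comm b0 m.
Proof. by rewrite /bimod_comm lactDl ractDr opprD addrACA. Qed.

(** Both S and the commutator with a0 are module generalized d-derivations for
    the same d, so the terms involving d cancel in their difference. *)
Lemma bimod_endo_sub_comm (d : {linear A -> A}) (S : {linear M -> M}) (a0 : A) :
    mod_generalized_derivation d S -> (forall a, d a = a0 * a - a * a0) ->
  bimod_endo (S \- bimod_comm a0).
Proof.
move=> dS da0 a m; have [Sl Sr] := dS a m.
split; rewrite /= /bimod_comm ?Sl ?Sr da0.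
- rewrite !lactDl !lactDr !lactN lactDr lactN lactNl !lactA lract.
  rewrite -addrA; congr (_ + _); rewrite !opprD !opprK.
  by rewrite addrACA subrr add0r.
- rewrite !ractDr !ractDl !ractN ractDl ractN ractNr !ractA lract.
  rewrite -addrA; congr (_ + _); rewrite !opprD !opprK.
  by rewrite addrC -addrA; congr (_ + _); rewrite addrC subrK.
Qed.

End BimoduleCommutator.

Arguments bimod_comm {R A M} a0 m.

Section BlockMaps.
Variables (R : comPzRingType) (A : pzAlgType R) (M : bimodType A).

Definition block_map (d : A -> A) (T : M -> A) (delta : A -> M) (S : M -> M)
  (x : trivext M) : trivext M := (d x.1 + T x.2, delta x.1 + S x.2).

Section Linear.
Variables (d : {linear A -> A}) (T : {linear M -> A}).
Variables (delta : {linear A -> M}) (S : {linear M -> M}).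

Lemma block_map_linear : linear (block_map d T delta S).
Proof.
move=> r [a m] [b n]; rewrite /block_map /= !linearP.
by congr (_, _) => /=; rewrite scalerDr addrACA.
Qed.

HB.instance Definition _ := GRing.isLinear.Build R (trivext M) (trivext M)
  *:%R (block_map d T delta S) block_map_linear.

End Linear.

Lemma block_mapP (D : {linear trivext M -> trivext M}) :
  exists (d : {linear A -> A}) (T : {linear M -> A})
         (delta : {linear A -> M}) (S : {linear M -> M}),
    D =1 block_map d T delta S.
Proof.
pose inA (a : A) : trivext M := (a, 0).
pose inM (m : M) : trivext M := (0, m).
have inA_lin : linear inA.
  by move=> r a b; congr (_, _) => /=; rewrite scaler0 addr0.
have inM_lin : linear inM.
  by move=> r m n; congr (_, _) => /=; rewrite scaler0 addr0.
have dP : linear (fun a => (D (inA a)).1).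
  by move=> r a b; rewrite inA_lin linearP.
have TP : linear (fun m => (D (inM m)).1).
  by move=> r m n; rewrite inM_lin linearP.
have deltaP : linear (fun a => (D (inA a)).2).
  by move=> r a b; rewrite inA_lin linearP.
have SP : linear (fun m => (D (inM m)).2).
  by move=> r m n; rewrite inM_lin linearP.
pose d : {linear A -> A} :=
  HB.pack (fun a => (D (inA a)).1) (GRing.isLinear.Build R A A *:%R _ dP).
pose T : {linear M -> A} :=
  HB.pack (fun m => (D (inM m)).1) (GRing.isLinear.Build R M A *:%R _ TP).
pose delta : {linear A -> M} :=
  HB.pack (fun a => (D (inA a)).2) (GRing.isLinear.Build R A M *:%R _ deltaP).
pose S : {linear M -> M} :=
  HB.pack (fun m => (D (inM m)).2) (GRing.isLinear.Build R M M *:%R _ SP).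
exists d, T, delta, S => -[a m].
have -> : (a, m) = inA a + inM m :> trivext M.
  by congr (_, _) => /=; rewrite ?addr0 ?add0r.
by rewrite linearD /block_map /= addr0 add0r; case: (D _) (D _) => [? ?] [].
Qed.

Section Entries.
Variables (d : {linear A -> A}) (T : {linear M -> A}).
Variables (delta : {linear A -> M}) (S : {linear M -> M}).

(** A product of two elements, each in A or in M, has a single component, so
    the two coordinates of the Leibniz rule involve different entries;
    (0, m)(0, n) = 0 is what forces T m n + m T n = 0. Only d and S are linked,
    through the M-coordinates of (a, 0)(0, m) and (0, m)(a, 0). *)
Lemma derivation_block_map :
  derivation (block_map d T delta S) <->
  [/\ derivation d, calE T, mod_derivation delta
    & mod_generalized_derivation d S].
Proof.
split=> [derD | [derd [homT skewT] derdelta genS] [a m] [b n]].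
  have rule x y : block_map d T delta S (x * y) =
    block_map d T delta S x * y + x * block_map d T delta S y := derD x y.
  have AA a b := rule (a, 0) (b, 0).
  have AM a m := rule (a, 0) (0, m).
  have MA a m := rule (0, m) (a, 0).
  have MM m n := rule (0, m) (0, n).
  split; first 1 last.
  - split=> [a m|m n].
      split.
        have /(congr1 fst) := AM a m.
        by rewrite /= !(linear0, mulr0, mul0r, lact0, ract0r, addr0, add0r).
      have /(congr1 fst) := MA a m.
      by rewrite /= !(linear0, mulr0, mul0r, lact0l, ract0, addr0, add0r).
    have /(congr1 snd) := MM m n.
    by rewrite /= !(linear0, mulr0, lact0l, ract0r, addr0, add0r) => <-.
  - move=> a b; have /(congr1 snd) := AA a b.
    by rewrite /= !(linear0, lact0, ract0, addr0, add0r).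
  - move=> a m; split.
      have /(congr1 snd) := AM a m.
      rewrite /= !(linear0, mulr0, lact0, ract0r, ract0, addr0, add0r) => ->.
      exact: addrC.
    have /(congr1 snd) := MA a m.
    by rewrite /= !(linear0, mul0r, lact0l, lact0, ract0, addr0, add0r).
  - move=> a b; have /(congr1 fst) := AA a b.
    by rewrite /= !(linear0, lact0, ract0, addr0, add0r).
congr (_, _) => /=.
  rewrite derd linearD (homT _ _).1 (homT _ _).2 mulrDl mulrDr.
  by rewrite [_ + T m * b]addrC addrACA.
have [Sl _] := genS a n; have [_ Sr] := genS b m.
rewrite derdelta linearD Sl Sr !lactDl !lactDr !ractDl !ractDr.
(* The right-hand side exceeds the left-hand one by T m n + m T n, which is
   grouped last and vanishes because T lies in E(M). *)
rewrite [RHS](AC ((2*2)*(2*2)) ((3*5)*((6*1)*(4*7))*(2*8)))%AC /=.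
by rewrite skewT addr0.
Qed.

(** A commutator has no M -> A entry because M is an ideal. The element a0
    serves d and S simultaneously, whereas m0 occurs in delta alone. *)
Lemma inner_block_map :
  inner (block_map d T delta S) <->
  (forall m, T m = 0) /\
  exists a0 m0, [/\ forall a, d a = a0 * a - a * a0,
    forall a, delta a = m0 <* a - a *> m0
    & forall m, S m = bimod_comm a0 m].
Proof.
split=> [[[a0 m0] eqD] | [T0 [a0 [m0 [da0 deltam0 Sa0]]]]].
  have DA a := eqD (a, 0); have DM m := eqD (0, m).
  split=> [m|].
    have /(congr1 fst) := DM m.
    by rewrite /= linear0 mulr0 mul0r subrr add0r.
  exists a0, m0; split=> [a|a|m].
  - have /(congr1 fst) := DA a.
    by rewrite /= linear0 addr0.
  - have /(congr1 snd) := DA a.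
    by rewrite /= !(linear0, lact0, ract0, addr0, add0r).
  - have /(congr1 snd) := DM m.
    by rewrite /= !(linear0, lact0l, ract0r, addr0, add0r).
exists (a0, m0) => -[a m]; congr (_, _) => /=.
  by rewrite T0 addr0 da0.
by rewrite deltam0 Sa0 /bimod_comm addrC addrACA -opprD [m <* a0 + _]addrC.
Qed.

End Entries.
End BlockMaps.

Arguments block_map {R A M} d T delta S x.
Arguments block_mapP {R A M} D.
Arguments derivation_block_map {R A M} d T delta S.
Arguments inner_block_map {R A M} d T delta S.

Theorem corollary4p8 (R : comPzRingType) (A : pzAlgType R) (M : bimodType A) :
  (forall D : {linear trivext M -> trivext M}, derivation D -> inner D) <->
  [/\ forall d : {linear A -> A}, Gamma_bar M d -> inner d,
      forall d : {linear A -> M}, mod_derivation d -> mod_inner d,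
      forall f : {linear M -> M}, bimod_endo f -> central_inner f
    & forall f : {linear M -> A}, calE f -> forall m : M, f m = 0].
Proof.
split=> [allinner | [Gamma_inner A_inner endo_inner E0] D].
  have inner_entries d T delta S entriesP :=
    (inner_block_map d T delta S).1
      (allinner _ ((derivation_block_map d T delta S).2 entriesP)).
  have der0 : derivation (\0 : {linear A -> A}).
    by move=> a b; rewrite /= mul0r mulr0 addr0.
  have E_0 : calE (\0 : {linear M -> A}).
    split=> [a m|m n] /=; first by rewrite mul0r mulr0.
    by rewrite lact0l ract0r addr0.
  have mod_der0 : mod_derivation (\0 : {linear A -> M}).
    by move=> a b; rewrite /= lact0 ract0 addr0.
  have gen0 (f : {linear M -> M}) :
      bimod_endo f -> mod_generalized_derivation (\0 : {linear A -> A}) f.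
    by move=> fP a m; rewrite /= lact0l ract0r !addr0.
  have endo0 : bimod_endo (\0 : {linear M -> M}).
    by move=> a m; rewrite /= lact0 ract0.
  split=> [d [derd [S genS]] | delta derdelta | f endof | T ET].
  - have [_ [a0 [_ [da0 _ _]]]] :=
      inner_entries _ _ _ _ (And4 derd E_0 mod_der0 genS).
    by exists a0.
  - have [_ [_ [m0 [_ dm0 _]]]] :=
      inner_entries _ _ _ _ (And4 der0 E_0 derdelta (gen0 _ endo0)).
    by exists m0.
  - have [_ [a0 [_ [da0 _ fa0]]]] :=
      inner_entries _ _ _ _ (And4 der0 E_0 mod_der0 (gen0 _ endof)).
    (* Here d = 0 is the commutator with a0, so a0 is central. *)
    exists a0; split=> // a.
    by apply/eqP; rewrite -subr_eq0 -da0.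
  - by have [] :=
      inner_entries _ _ _ _ (And4 der0 ET mod_der0 (gen0 _ endo0)).
move=> derD; have [d [T [delta [S DE]]]] := block_mapP D.
have /derivation_block_map[derd ET derdelta genS] :
    derivation (block_map d T delta S).
  by move=> x y; rewrite /= -!DE.
have [a0 da0] : inner d by apply: Gamma_inner; split=> //; exists S.
have [m0 deltam0] := A_inner _ derdelta.
have [b0 [b0C Sb0]] := endo_inner _ (bimod_endo_sub_comm _ _ _ _ _ _ genS da0).
have [c cE] : inner (block_map d T delta S).
  apply/inner_block_map; split; first exact: E0.
  (* b0 corrects a0 on M, and being central leaves its commutators on A alone. *)
  exists (a0 + b0), m0; split=> // [a|m].
    by rewrite da0 mulrDl mulrDr b0C opprD addrACA subrr addr0.
  by rewrite bimod_commD -[bimod_comm b0 m]Sb0 /= addrC subrK.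
by exists c => x; rewrite DE cE.
Qed.
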